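(* Let $n\ge 4$ be an integer. There exists an orthogonal Latin hypercube of $n$ runs with more than one factor if and only if $n\ne 4k+2$ for any integer $k$.
   Context: A Latin hypercube of $n\ge 2$ runs with $m$ factors is an $n\times m$ matrix each of whose columns is a permutation of the $n$ levels $-(n-1)/2,-(n-3)/2,\ldots,(n-3)/2,(n-1)/2$. It is called orthogonal if $x_i^Tx_j=0$ for every two distinct columns $x_i,x_j$. The number of factors is the number of columns. *)

(* Defs.v *)
From mathcomp Require Import all_boot all_order all_fingroup all_algebra.

Set Implicit Arguments.
Unset Strict Implicit.
Unset Printing Implicit Defensive.

Import GRing.Theory Num.Theory.
Local Open Scope ring_scope.

(* The levels -(n-1)/2, -(n-3)/2, ..., (n-3)/2, (n-1)/2, indexed from 0.
   They are (half-)integers, so rational entries lose no generality. *)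
Definition level (n : nat) (i : 'I_n) : rat := i%:R - (n%:R - 1) / 2%:R.

Definition latin_hypercube (n m : nat) (L : 'M[rat]_(n, m)) : Prop :=
  forall j : 'I_m, exists s : 'S_n, col j L = \col_(i < n) level (s i).

(* Columns are distinct as factors, i.e. when their indices are. *)
Definition orthogonal_columns (n m : nat) (L : 'M[rat]_(n, m)) : Prop :=
  forall i j : 'I_m, i != j -> (col i L)^T *m col j L = 0.

Definition orthogonal_latin_hypercube (n m : nat) (L : 'M[rat]_(n, m)) : Prop :=
  latin_hypercube L /\ orthogonal_columns L.

(* Main.v *)
Require Import Defs.
From mathcomp Require Import all_boot all_order all_fingroup all_algebra.
From mathcomp Require Import zify ring.
Import GRing.Theory Num.Theory.
Local Open Scope ring_scope.

(** Centring turns orthogonality of two columns [level \o s] and [level \o t]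
    into [4 * \sum_i s i * t i = n (n - 1) ^ 2], which is impossible modulo 4
    when [n] is [4 k + 2]. Conversely, a permutation [f] of the levels
    orthogonal to the identity extends from [n] to [n + 4] runs: the four new
    extreme levels [-x, -y, y, x] are sent to [-y, x, -x, y], which contributes
    [xy - xy - xy + xy = 0]. The bases are [n = 0], [n = 1] and [n = 7]. *)

Lemma sum_level (n : nat) : \sum_(i < n) level i = 0.
Proof.
have -> : \sum_(i < n) level i = \sum_(i < n) (i%:R - (n%:R - 1) / 2%:R : rat).
  by [].
rewrite big_split /= sumr_const card_ord -mulr_natr.
suff -> : \sum_(i < n) (i%:R : rat) = n%:R * (n%:R - 1) / 2%:R by field.
elim: n => [|n IHn]; first by rewrite big_ord0 !mul0r.
by rewrite big_ord_recr /= IHn -natr1; field.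
Qed.

(** The cross terms are multiples of column sums, which vanish, so an integer sum and a constant
    remain. *)
Lemma sum_level_mul (n : nat) (s t : 'S_n) :
  \sum_(i < n) level (s i) * level (t i) =
  (\sum_(i < n) s i * t i)%N%:R - n%:R * ((n%:R - 1) / 2%:R) ^+ 2.
Proof.
have sum_perm (u : 'S_n) : \sum_(i < n) level (u i) = 0.
  by rewrite -[RHS](sum_level n) [RHS](reindex_inj (@perm_inj _ u)).
set c := (n%:R - 1) / 2%:R.
have E i : level (s i) * level (t i) =
    ((s i * t i)%N%:R - c ^+ 2) - (c * level (s i) + c * level (t i)).
  by rewrite /level -/c natrM; ring.
rewrite (eq_bigr _ (fun i _ => E i)) !sumrB sumr_const card_ord.
rewrite -[_ ^+ 2 *+ n]mulr_natl big_split /= -!mulr_sumr !sum_perm.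
by rewrite -natr_sum mulr0 addr0.
Qed.

Lemma mul_tr_col (n m : nat) (L : 'M[rat]_(n, m)) (j k : 'I_m) (s t : 'S_n) :
  col j L = \col_i level (s i) -> col k L = \col_i level (t i) ->
  (col j L)^T *m col k L = (\sum_(i < n) level (s i) * level (t i))%:M.
Proof.
move=> -> ->; apply/matrixP=> a b; rewrite !ord1 !mxE mulr1n.
by apply: eq_bigr => i _; rewrite !mxE.
Qed.

(** A function on [nat], relevant only below [n], avoids casts between ordinal types when [n] grows
    to [n.+4]. *)
Definition self_orthogonal (n : nat) (f : nat -> nat) : Prop :=
  [/\ forall i, (i < n)%N -> (f i < n)%N,
      forall i j, (i < n)%N -> (j < n)%N -> f i = f j -> i = j
    & \sum_(0 <= i < n) (i%:R - (n%:R - 1) / 2%:R) *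
        ((f i)%:R - (n%:R - 1) / 2%:R) = 0 :> rat].

Lemma self_orthogonal_add4 (n : nat) (f : nat -> nat) :
  self_orthogonal n f -> exists g, self_orthogonal n.+4 g.
Proof.
case=> f_lt f_inj f_sum.
(* The new extreme indices 0, 1, [n.+2], [n.+3] go to 1, [n.+3], 0, [n.+2]; the old ones sit in the
   middle, shifted by 2. *)
pose g i := if i is j.+2 then
    if (j < n)%N then (f j).+2 else if j == n then 0%N else n.+2
  else if i is 1 then n.+3 else 1%N.
exists g; split.
- move=> [|[|i]] //= ilt; case: ifP => [/f_lt|]; first by lia.
  by case: eqP.
- move=> [|[|i]] [|[|j]] //=; rewrite !ltnS => ilt jlt.
  + by case: ifP => //; case: eqP; lia.
  + by case: ifP => [/f_lt|]; [lia|case: eqP; lia].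
  + by case: ifP => //; case: eqP; lia.
  + by case: ifP => [/f_lt|]; [lia|case: eqP; lia].
  + case: (ltnP i n) => [iln|nli]; case: (ltnP j n) => [jln|nlj].
    * by case=> /(f_inj _ _ iln jln) ->.
    * by have := f_lt _ iln; case: eqP; lia.
    * by have := f_lt _ jln; case: eqP; lia.
    * by case: eqP; case: eqP; lia.
rewrite big_nat_recl // big_nat_recl // big_nat_recr // big_nat_recr //=.
rewrite ltnn eqxx ltnNge leqnSn /=.
have -> : (n.+1 == n) = false by lia.
(* Old levels are unchanged: the index and the centre both move by 2. *)
rewrite (eq_big_nat _ _ (F2 := fun i => (i%:R - (n%:R - 1) / 2%:R) *
        ((f i)%:R - (n%:R - 1) / 2%:R))); last first.
  by move=> i /andP[_ ->]; rewrite -!natr1; field.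
by rewrite f_sum -!natr1; field.
Qed.

Lemma exists_self_orthogonal (n : nat) :
  (n != 3)%N -> (n %% 4 != 2)%N -> exists f, self_orthogonal n f.
Proof.
have [k] := ubnP n; elim: k n => // k IHk n nk n3 n2.
have [->|n0] := eqVneq n 0%N.
  by exists id; split=> //; rewrite big_nil.
have [->|n1] := eqVneq n 1%N.
  by exists id; split=> //; rewrite big_nat1.
(* For [n = 3] no permutation of -1, 0, 1 is orthogonal to the identity, so the class of 3 modulo 4
   starts at 7, with an explicit witness. *)
have [->|n7] := eqVneq n 7%N.
  exists (nth 0%N [:: 5; 3; 1; 4; 0; 2; 6]); split.
  - by do 7!case=> //.
  - by do 7!(case=> [|]) => //; do 7!(case=> [|]) => //.
  - by rewrite unlock.
case: n => [|[|[|[|n]]]] // in nk n3 n2 n0 n1 n7 *.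
(* The smaller [n] is not 3, since [n.+4] is not 7. *)
have [||//|f] := IHk n; try by lia.
exact: self_orthogonal_add4.
Qed.

Lemma self_orthogonal_perm (n : nat) (f : nat -> nat) :
  self_orthogonal n f ->
  exists s : 'S_n, \sum_(i < n) level i * level (s i) = 0.
Proof.
case=> f_lt f_inj f_sum.
pose g (i : 'I_n) := Ordinal (f_lt i (ltn_ord i)).
have g_inj : injective g by move=> i j [] /f_inj eq_ij; apply/val_inj/eq_ij.
exists (perm g_inj); rewrite -[RHS]f_sum big_mkord.
by apply: eq_bigr => i _; rewrite permE.
Qed.

Theorem theorem2 (n : nat) (hn : (4 <= n)%N) :
  (exists (m : nat) (L : 'M[rat]_(n, m)),
      (1 < m)%N /\ orthogonal_latin_hypercube L)
  <-> (forall k : int, n%:Z <> 4 * k + 2).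
Proof.
split=> [[m] [L] [m_gt1 [latinL orthL]] k nE|nE].
  pose j0 := Ordinal (ltnW m_gt1); pose j1 := Ordinal m_gt1.
  have [s sE] := latinL j0; have [t tE] := latinL j1.
  have := orthL j0 j1 isT; rewrite (mul_tr_col _ _ _ _ _ _ _ sE tE).
  move=> /matrixP/(_ ord0 ord0); rewrite !mxE mulr1n sum_level_mul.
  set S := (\sum_(i < n) _)%N => E.
  have : (S * 4)%N%:R = (n * (n.-1 * n.-1))%N%:R :> rat.
    rewrite !natrM -subn1 natrB; last exact: ltnW (ltnW (ltnW hn)).
    by move/subr0_eq: E => ->; field.
  move/eqP; rewrite eqr_nat => /eqP {}E.
  have [q nq] : exists q, n = (4 * q + 2)%N by exists (n %/ 4)%N; lia.
  (* Here [n] is twice an odd number and [n.-1] is odd, so the right side is 2 modulo 4 while the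
     left is a multiple of 4. *)
  by move: E; rewrite nq addn2 /=; nia.
have [||f /self_orthogonal_perm[s s0]] := exists_self_orthogonal n.
- by lia.
- by apply/negP=> /eqP n2; apply: (nE (n %/ 4)%N%:Z); lia.
pose p (j : 'I_2) : 'S_n := if j == ord0 then 1%g else s.
pose L := \matrix_(i < n, j < 2) level (p j i).
have LE j : col j L = \col_i level (p j i) by apply/colP=> i; rewrite !mxE.
exists 2%N, L; split=> //; split=> [j|j k jk]; first by exists (p j).
rewrite (mul_tr_col _ _ _ _ _ _ _ (LE j) (LE k)).
suff -> : \sum_(i < n) level (p j i) * level (p k i) = 0 by rewrite raddf0.
(* Only the pairs (0, 1) and (1, 0) remain; they differ by commutativity. *)
rewrite -[RHS]s0; case: j k jk => [[|[|]]] // hj [[|[|]]] // hk _;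
  by apply: eq_bigr => i _; rewrite /p /= perm1 // mulrC.
Qed.
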